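(* Let $\{\Theta_{kj}\}_{k,j\in[K]}$ be i.i.d. uniform on $[-\pi,\pi)$. For $\mathbf{P}=(P_1,\dots,P_K)\in[0,1]^K$ and $(\boldsymbol{\alpha},\boldsymbol{\gamma})\in[-\pi,\pi)^{2K}$ define $\beta_{kj}=\cos^2(\alpha_j+\Theta_{kj}-\Theta_{jj}-\gamma_k)$ and $$R_{sum}(\mathbf{P},\boldsymbol{\alpha},\boldsymbol{\gamma})=\sum_{k=1}^K \ln\!\left(1+\frac{P_k\beta_{kk}}{\sum_{j\ne k}P_j\beta_{kj}+\frac12}\right).$$ Then no single-symbol phase alignment scheme can achieve a sum-rate better than $O(\ln K)$ with high probability; that is, there exists a constant $C>0$ such that $$\mathbb{P}\left[\max_{\mathbf{P}\in[0,1]^K,\ (\boldsymbol{\alpha},\boldsymbol{\gamma})\in[-\pi,\pi)^{2K}} R_{sum}(\mathbf{P},\boldsymbol{\alpha},\boldsymbol{\gamma})\le C\ln K\right]\to 1 \quad\text{as } K\to\infty.$$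
   Context: Setting: $K$-user phase-fading complex Gaussian interference channel $Y_k[t]=\sum_j e^{i\Theta_{kj}}X_j[t]+Z_k[t]$ with $Z_k[t]\sim\mathcal{CN}(0,1)$ i.i.d. and time-invariant phases $\Theta_{kj}$ i.i.d. uniform on $[-\pi,\pi)$. A single-symbol phase alignment scheme is one in which each transmitter $k$ uses a real Gaussian codebook with average power $P_k\in[0,1]$, sending $X_k[t]=\sqrt{P_k}e^{i(\alpha_k-\Theta_{kk})}U_k[t]$ with $U_k[t]$ real and unit average power (linear precoding confined to a single complex symbol), and each receiver $k$ treats interference as noise after projecting its received signal onto direction $e^{i\gamma_k}$ (i.e., taking $\mathsf{Re}(e^{-i\gamma_k}Y_k[t])$). The resulting rate of user $k$ is $\ln\bigl(1+\frac{P_k\beta_{kk}}{\sum_{j\ne k}P_j\beta_{kj}+1/2}\bigr)$, so the best sum-rate in this class is the maximum of $R_{sum}$ displayed in the claim. The probability is over the phases $\{\Theta_{kj}\}$. *)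

(* Defs.v *)
From HB Require Import structures.
From mathcomp Require Import all_boot all_order all_algebra.
From mathcomp Require Import all_classical all_reals all_analysis.
Set Implicit Arguments. Unset Strict Implicit. Unset Printing Implicit Defensive.
Import Order.TTheory GRing.Theory Num.Theory.
Local Open Scope classical_set_scope.
Local Open Scope ring_scope.

Definition beta_coef {R : realType} (K : nat) (th : 'I_K -> 'I_K -> R)
  (al ga : 'I_K -> R) (k j : 'I_K) : R :=
  cos (al j + th k j - th j j - ga k) ^+ 2.

Definition Rsum {R : realType} (K : nat) (th : 'I_K -> 'I_K -> R)
  (Pw al ga : 'I_K -> R) : R :=
  \sum_(k < K)
    ln (1 + Pw k * beta_coef th al ga k k /
            (\sum_(j < K | j != k) Pw j * beta_coef th al ga k j + 2^-1)).

Definition iid_uniform_phases {R : realType} (K : nat) {d : measure_display}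
  {T : measurableType d} (P : probability T R) (Theta : 'I_K -> 'I_K -> T -> R)
  : Prop :=
  [/\ (forall k j, measurable_fun setT (Theta k j)),
      (forall B : 'I_K -> 'I_K -> set R, (forall k j, measurable (B k j)) ->
         P [set t | forall k j, B k j (Theta k j t)] =
         (\prod_(k < K) \prod_(j < K) P (Theta k j @^-1` B k j))%E) &
      (forall k j (B : set R), measurable B ->
         P (Theta k j @^-1` B) =
         (lebesgue_measure (B `&` `[(- pi)%R, pi%R[%classic) * ((2 * pi)^-1)%:E)%E)].

Definition max_sumrate_le {R : realType} (K : nat) (th : 'I_K -> 'I_K -> R)
  (c : R) : Prop :=
  forall Pw al ga : 'I_K -> R,
    (forall k, 0 <= Pw k <= 1) ->
    (forall k, - pi <= al k < pi) ->
    (forall k, - pi <= ga k < pi) ->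
    Rsum th Pw al ga <= c.

(* Main.v *)
(* Absorbing Theta_jj into alpha_j makes the transmit angles arbitrary reals, and
   these and the receive angles may be rounded to a grid of fixed mesh pi / L. A
   link with cos^2 < sin^2 (pi / L) then forces Theta_kj into an arc of
   probability at most 12 / L. A union bound over m receivers, m transmitters,
   their grid angles and the set of such weak links shows that, with probability
   at least 1 - 2 / K, no choice of angles makes half of the links of an m x m
   block weak, for all m >= m0 = O(ln K).

   On that event, among any n >= 2 m0 users, at least half of the links from n/2
   users to the n/2 least powerful ones are not weak. So one of the latter hears
   about n/4 interferers at least as powerful as itself, and its rate is O(1 / n).
   Removing such users one by one bounds the sum-rate by O(sum 1 / n) + O(m0),
   which is O(ln K). *)
Require Import Defs.
From HB Require Import structures.
From mathcomp Require Import all_boot all_order all_algebra.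
From mathcomp Require Import all_classical all_reals all_analysis measurable_realfun.
From mathcomp Require Import ring lra zify.
Set Implicit Arguments. Unset Strict Implicit. Unset Printing Implicit Defensive.
Import numFieldNormedType.Exports.
Import Order.TTheory GRing.Theory Num.Theory.
Local Open Scope classical_set_scope.
Local Open Scope ring_scope.

(** * Zeros of the cosine and rounding of angles *)

Lemma cos_sqDpi_int (R : realType) (n : int) (x : R) :
  cos (x + n%:~R * pi) ^+ 2 = cos x ^+ 2.
Proof.
have H (m : nat) (y : R) : cos (y + m%:R * pi) ^+ 2 = cos y ^+ 2.
  by rewrite mulr_natl (alternatingn (@cosDpi R)) exprMn -exprM mulnC exprM
     sqrrN expr1n expr1n mul1r.
case: n => n; first exact: H.
rewrite NegzE -(H n.+1 (x + _)); congr (cos _ ^+ 2).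
by rewrite mulrNz mulNr pmulrn subrK.
Qed.

Lemma le_sin_pi (R : realType) (e y : R) :
  0 <= e -> e <= pi / 2 -> e <= y -> y <= pi - e -> sin e <= sin y.
Proof.
move=> e0 e2 ey ye.
have sin_le (u v : R) : 0 <= u -> u <= v -> v <= pi / 2 -> sin u <= sin v.
  move=> u0 uv v2; have [->//|neq] := eqVneq u v.
  by apply/ltW; rewrite ltr_sin ?lt_neqAle ?neq ?uv// in_itv /=; lra.
have [y2|y2] := leP y (pi / 2); first exact: sin_le.
have -> : sin y = sin (pi - y).
  by rewrite -[in LHS](subrK pi y) sinDpi -sinN opprB.
by apply: sin_le; lra.
Qed.

(* The angles th for which th + c is within r of a zero of the cosine. *)
Definition near_null (R : realType) (r c : R) : set R :=
  \bigcup_(n : int) ball (n%:~R * pi + pi / 2 - c) r.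

(** Write x = y + pi/2 + n pi with 0 <= y < pi, so that cos^2 x = sin^2 y. By [le_sin_pi], y cannot
    lie in [e, pi - e]; hence x is within e of the zero with index n or of the next one. *)
Lemma cos_sq_lt_near_null (R : realType) (e x : R) :
  0 <= e -> e <= pi / 2 -> cos x ^+ 2 < sin e ^+ 2 -> near_null e 0 x.
Proof.
move=> e0 e2; have p0 := pi_gt0 R.
pose n := Num.floor ((x - pi / 2) / pi).
have /andP[] := floor_itv ((x - pi / 2) / pi); rewrite -/n.
rewrite ler_pdivlMr// ltr_pdivrMr// intrD1 => n1 n2.
pose y := x - pi / 2 - n%:~R * pi.
have y0 : 0 <= y by rewrite /y; lra.
have yp : y < pi by rewrite /y; lra.
have -> : cos x ^+ 2 = sin y ^+ 2.
  rewrite -(cos_sqDpi_int (- n)) -[RHS]sqrrN -cosDpihalf; congr (cos _ ^+ 2).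
  by rewrite /y mulrNz; ring.
move=> lt.
have se : 0 <= sin e by apply: sin_ge0_pi; lra.
have sy : sin y < sin e.
  by rewrite -(@ltr_pXn2r _ 2)// nnegrE// sin_ge0_pi// y0 ltW.
have [ye|ey] := ltP y e.
  exists n => //; rewrite /ball /= ltr_norml; move: y0 ye; rewrite /y => *; lra.
have [ye|ye] := leP y (pi - e).
  by have := @le_sin_pi R e y e0 e2 ey ye; lra.
exists (n + 1) => //; rewrite /ball /= ltr_norml intrD1; move: yp ye; rewrite /y => *; lra.
Qed.

(** As cos^2 has period pi, [L] grid points of mesh h = pi / L serve all real angles, each rounded
    down modulo pi. The two rounding errors lie in [0, h] and enter with opposite signs, so th is
    within 2 h of a zero of the shifted cosine; the radius 3 h leaves some slack. *)
Lemma grid_near_null (R : realType) (L : nat) : (2 <= L)%N ->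
  exists grid : R -> 'I_L, forall a g th : R,
    cos (a + th - g) ^+ 2 < sin (pi / L%:R) ^+ 2 ->
    near_null (3 * (pi / L%:R))
      ((grid a)%:R * (pi / L%:R) - (grid g)%:R * (pi / L%:R)) th.
Proof.
move=> L2; have p0 := pi_gt0 R.
have L2R : (2 : R) <= L%:R by rewrite ler_nat.
have L0 : (0 : R) < L%:R by lra.
set h : R := pi / L%:R.
have h0 : 0 < h by rewrite divr_gt0.
have hp : pi = L%:R * h by rewrite /h mulrC divfK ?gt_eqF.
have h2 : h <= pi / 2 by rewrite hp; nra.
suff /choice[grid gridP] : forall a : R, exists i : 'I_L,
    exists n : int, 0 <= a - i%:R * h - n%:~R * pi <= h.
  exists grid => a g th; move/(cos_sq_lt_near_null (ltW h0) h2) => [n _].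
  have [na ha] := gridP a; have [ng hg] := gridP g.
  rewrite /ball /= ltr_norml => hn.
  exists (n - na + ng) => //; rewrite /ball /= ltr_norml.
  by rewrite intrD intrB; lra.
move=> a; pose n := Num.floor (a / pi).
have /andP[] := floor_itv (a / pi); rewrite -/n.
rewrite ler_pdivlMr// ltr_pdivrMr// intrD1 => n1 n2.
pose y := a - n%:~R * pi.
have y0 : 0 <= y by rewrite /y; lra.
have yp : y < pi by rewrite /y; lra.
have yh0 : 0 <= y / h by rewrite divr_ge0// ltW.
have /andP[i1 i2] := truncn_itv yh0.
have iL : (Num.truncn (y / h) < L)%N.
  rewrite -(ltr_nat R); apply: le_lt_trans i1 _.
  by rewrite ltr_pdivrMr// -hp.
exists (Ordinal iL), n => /=.
move: i1 i2; rewrite ler_pdivlMr// ltr_pdivrMr// -natr1 /y => *; lra.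
Qed.

(** * Probability that one phase makes a link weak *)

Lemma measurable_near_null (R : realType) (r c : R) :
  measurable (near_null r c).
Proof. by apply: open_measurable; apply: bigcup_open => n _; exact: ball_open. Qed.

Lemma measure_bigsetU_le (d : measure_display) (T : measurableType d)
    (R : realType) (mu : {measure set T -> \bar R}) (I : Type) (s : seq I)
    (Q : pred I) (F : I -> set T) :
  (forall i, Q i -> measurable (F i)) ->
  (mu (\big[setU/set0]_(i <- s | Q i) F i) <= \sum_(i <- s | Q i) mu (F i))%E.
Proof.
move=> mF; elim: s => [|i s IH]; first by rewrite !big_nil measure0.
rewrite !big_cons; case: ifP => // Qi.
apply: le_trans (leeD (lexx _) IH); apply: measureU2; first exact: mF.
by apply: bigsetU_measurable.
Qed.

(** For these ranges of r and c, only the balls with -2 <= n <= 1 can meet [-pi, pi), and each has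
    length 2 r. The index i of [F] stands for n + 2. *)
Lemma lebesgue_near_null (R : realType) (r c : R) :
  0 <= r -> r <= pi / 2 -> - pi <= c <= pi ->
  (lebesgue_measure (near_null r c `&` `[(- pi)%R, pi%R[%classic) <= (8 * r)%:E)%E.
Proof.
move=> r0 r2 /andP[c1 c2]; have p0 := pi_gt0 R.
pose F (i : 'I_4) : set R := ball (((i : nat)%:R - 2) * pi + pi / 2 - c) r.
have mF i : measurable (F i) by apply: open_measurable; exact: ball_open.
apply: (@le_trans _ _ (lebesgue_measure (\big[setU/set0]_(i < 4) F i))).
  apply: le_measure; rewrite ?inE.
  - apply: measurableI; [exact: measurable_near_null|exact: measurable_itv].
  - by apply: bigsetU_measurable => i _; exact: mF.
  move=> x [[n _]]; rewrite /ball /= ltr_norml in_itv /= => /andP[n1 n2] /andP[x1 x2].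
  have lo : (-3)%:~R < n%:~R :> R by rewrite -(ltr_pM2r p0) ; lra.
  have hi : n%:~R < 2%:~R :> R by rewrite -(ltr_pM2r p0); lra.
  move: lo hi; rewrite !ltr_int => lo hi.
  have n4 : (absz (n + 2)%R < 4)%N by lia.
  rewrite -bigcup_mkord_ord; exists (absz (n + 2)) => //=.
  rewrite /F /ball /= ltr_norml inordK//.
  have -> : ((absz (n + 2))%:R : R) = n%:~R + 2.
    by rewrite -[LHS]/((Posz (absz (n + 2)))%:~R) gez0_abs ?intrD//; lia.
  by lra.
apply: le_trans (measure_bigsetU_le _ _ _) _; first by move=> i _; exact: mF.
rewrite (eq_bigr (fun=> (r *+ 2)%:E)); last first.
  by move=> i _; rewrite -(lebesgue_measure_ball (((i : nat)%:R - 2) * pi + pi / 2 - c) r0).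
by rewrite sumEFin lee_fin sumr_const card_ord -mulr_natr -[_ *+ 4]mulr_natr; lra.
Qed.

(** The density 1 / (2 pi) turns the length 8 * (3 pi / L) into 12 / L; [6 <= L] keeps the radius 3
    pi / L below pi / 2. *)
Lemma prob_near_null (R : realType) (K : nat) (d : measure_display)
    (T : measurableType d) (P : probability T R) (Theta : 'I_K -> 'I_K -> T -> R)
    (L : nat) (c : R) (k j : 'I_K) :
  iid_uniform_phases P Theta -> (6 <= L)%N -> - pi <= c <= pi ->
  (P (Theta k j @^-1` near_null (3 * (pi / L%:R)) c) <= (12 / L%:R)%:E)%E.
Proof.
move=> [_ _ unif] L6 cpi; have p0 := pi_gt0 R.
have L6R : (6 : R) <= L%:R by rewrite ler_nat.
rewrite unif; last exact: measurable_near_null.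
set h : R := pi / L%:R.
have hp : pi = L%:R * h by rewrite /h mulrC divfK ?gt_eqF//; lra.
have h0 : 0 < h by rewrite divr_gt0//; lra.
apply: (@le_trans _ _ ((8 * (3 * h))%:E * ((2 * pi)^-1)%:E)%E).
  apply: lee_wpmul2r; first by rewrite lee_fin invr_ge0; lra.
  apply: lebesgue_near_null => //; first by lra.
  by rewrite hp; nra.
rewrite -EFinM lee_fin /h le_eqVlt; apply/orP; left; apply/eqP; field.
by rewrite !gt_eqF//; lra.
Qed.

(** * Union bound over blocks, grid angles and sets of weak links *)

Lemma prob_cylinder_le (R : realType) (K : nat) (d : measure_display)
    (T : measurableType d) (P : probability T R) (Theta : 'I_K -> 'I_K -> T -> R)
    (I : finType) (D : {set I}) (phi : I -> 'I_K * 'I_K) (B : I -> set R) (q : R) :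
  iid_uniform_phases P Theta -> injective phi -> (forall i, measurable (B i)) ->
  (forall i, P (Theta (phi i).1 (phi i).2 @^-1` B i) <= q%:E)%E ->
  (P [set t | forall i, i \in D -> B i (Theta (phi i).1 (phi i).2 t)]
     <= (q ^+ #|D|)%:E)%E.
Proof.
move=> [mTh indep _] phi_inj mB Bq.
(* The product formula wants one set for every link. Off the image of [D] the intersection is empty,
   hence the whole line, with factor at most 1; on the image the factor is at most q, and
   injectivity of [phi] gives #|D| such links. *)
pose C (k j : 'I_K) : set R :=
  \bigcap_(i in [set i | i \in D /\ phi i = (k, j)]) B i.
have mC k j : measurable (C k j).
  by apply: fin_bigcap_measurable => //; exact: finite_finset.
have -> : [set t | forall i, i \in D -> B i (Theta (phi i).1 (phi i).2 t)] =
          [set t | forall k j, C k j (Theta k j t)].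
  apply/seteqP; split => t /= Ht.
    by move=> k j i /= [iD ij]; have := Ht i iD; rewrite ij.
  move=> i iD; apply: (Ht (phi i).1 (phi i).2 i) => /=.
  by split=> //; case: (phi i).
rewrite indep// pair_big /=.
have mpre (k j : 'I_K) (X : set R) : measurable X -> measurable (Theta k j @^-1` X).
  by move=> mX; rewrite -[X in measurable X]setTI; exact: mTh.
have Pfin (X : set T) : measurable X -> P X = (fine (P X))%:E.
  by move=> mX; rewrite fineK// fin_num_measure.
rewrite (eq_bigr (fun p => (fine (P (Theta p.1 p.2 @^-1` C p.1 p.2)))%:E));
  last by move=> p _; rewrite [LHS]Pfin//; exact: mpre.
rewrite prodEFin lee_fin.
have -> : q ^+ #|D| = \prod_(p : 'I_K * 'I_K) (if p \in phi @: D then q else 1).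
  by rewrite -big_mkcond /= prodr_const card_imset.
apply: ler_prod => -[k j] _ /=; rewrite fine_ge0//=.
rewrite -lee_fin -Pfin; last exact: mpre.
case: ifPn => [/imsetP[i iD ij]|_]; last exact/probability_le1/mpre.
have := Bq i; rewrite -ij /=; apply: le_trans.
apply: le_measure; rewrite ?inE; [exact: mpre|exact: mpre|].
by move=> t /= Ct; exact: Ct.
Qed.

(* A block of m receivers with their rounded angles gamma, m transmitters with
   their rounded angles alpha_j - Theta_jj, and a set of links of the block. *)
Definition config (K L m : nat) : finType :=
  ({ffun 'I_m -> 'I_K * 'I_L} * {ffun 'I_m -> 'I_K * 'I_L} *
   {set 'I_m * 'I_m})%type.

(** Injectivity makes distinct links of the block carry distinct, hence independent, phases. A user
    may still occur both as receiver and as transmitter. *)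
Definition admissible (K L m : nat) (w : config K L m) : bool :=
  [&& injectiveb (fun u => (w.1.1 u).1), injectiveb (fun v => (w.1.2 v).1) &
      (m * m <= 2 * #|w.2|)%N].

(** Only grid angles fixed by [w] occur in the centres, so for given [w] this is a cylinder event in
    the phases of the block. *)
Definition aligned (R : realType) (K L m : nat) (th : 'I_K -> 'I_K -> R)
    (w : config K L m) : Prop :=
  forall p, p \in w.2 ->
    near_null (3 * (pi / L%:R))
      ((w.1.2 p.2).2%:R * (pi / L%:R) - (w.1.1 p.1).2%:R * (pi / L%:R))
      (th (w.1.1 p.1).1 (w.1.2 p.2).1).

Lemma measurable_aligned (R : realType) (K L m : nat) (d : measure_display)
    (T : measurableType d) (Theta : 'I_K -> 'I_K -> T -> R) (w : config K L m) :
  (forall k j, measurable_fun setT (Theta k j)) ->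
  measurable [set t | aligned (fun k j => Theta k j t) w].
Proof.
move=> mTh.
pose F p := Theta (w.1.1 p.1).1 (w.1.2 p.2).1 @^-1` near_null (3 * (pi / L%:R))
  ((w.1.2 p.2).2%:R * (pi / L%:R) - (w.1.1 p.1).2%:R * (pi / L%:R)).
rewrite (_ : [set t | _] = \bigcap_(p in [set p | p \in w.2]) F p).
  apply: fin_bigcap_measurable => [|p _]; first exact: finite_finset.
  by rewrite -[F p]setTI; apply: mTh => //; exact: measurable_near_null.
by apply/seteqP; split => t /= Ht p /=; exact: Ht.
Qed.

(** Since 768 = 12 * 2^6, each prescribed weak link has probability at most 2^-6, and at least m^2 /
    2 of them are independent. *)
Lemma prob_aligned (R : realType) (K L m : nat) (d : measure_display)
    (T : measurableType d) (P : probability T R) (Theta : 'I_K -> 'I_K -> T -> R)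
    (w : config K L m) :
  iid_uniform_phases P Theta -> (768 <= L)%N -> admissible w ->
  (P [set t | aligned (fun k j => Theta k j t) w] <= (2 ^- (3 * (m * m)))%:E)%E.
Proof.
move=> iid L768 /and3P[/injectiveP f_inj /injectiveP g_inj mD].
pose phi (p : 'I_m * 'I_m) := ((w.1.1 p.1).1, (w.1.2 p.2).1).
have phi_inj : injective phi by move=> [u v] [u' v'] [/f_inj /= -> /g_inj /= ->].
have L768R : (768 : R) <= L%:R by rewrite (ler_nat R 768).
have p0 := pi_gt0 R.
have h0 : 0 < pi / L%:R :> R by rewrite divr_gt0//; lra.
have hp : L%:R * (pi / L%:R) = pi :> R by rewrite mulrC divfK// gt_eqF//; lra.
have grid_le (i : 'I_L) : 0 <= i%:R * ((pi : R) / L%:R) <= (pi : R).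
  rewrite mulr_ge0 ?(ltW h0) ?ler0n//=.
  apply: (@le_trans _ _ (L%:R * (pi / L%:R))); last by rewrite hp.
  by rewrite ler_wpM2r ?(ltW h0)// ler_nat ltnW.
pose B (p : 'I_m * 'I_m) : set R := near_null (3 * (pi / L%:R))
  ((w.1.2 p.2).2%:R * (pi / L%:R) - (w.1.1 p.1).2%:R * (pi / L%:R)).
apply: le_trans (@prob_cylinder_le R K d T P Theta _ w.2 phi B (2^-1 ^+ 6)
  iid phi_inj _ _) _.
- by move=> p; exact: measurable_near_null.
- move=> p; apply: le_trans (prob_near_null _ _ iid _ _) _.
  + by apply: leq_trans L768; lia.
  + have := grid_le (w.1.2 p.2).2; have := grid_le (w.1.1 p.1).2.
    by move=> /andP[? ?] /andP[? ?]; apply/andP; split; lra.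
  + rewrite lee_fin ler_pdivrMr//; last lra.
    by rewrite -[leLHS]mulr1; lra.
rewrite lee_fin -exprM -exprVn; apply: ler_wiXn2l; [lra|lra|].
by move: mD; lia.
Qed.

Lemma card_config (K L m : nat) :
  #|config K L m| = ((K * L) ^ (2 * m) * 2 ^ (m * m))%N.
Proof.
rewrite /config !card_prod; congr (_ * _)%N.
  by rewrite !card_ffun !card_prod !card_ord mul2n -addnn expnD.
by rewrite -cardsT -powersetT card_powerset cardsT card_prod card_ord.
Qed.

Definition some_aligned (R : realType) (K L m0 : nat) (th : 'I_K -> 'I_K -> R) :
    Prop :=
  exists2 m : 'I_K.+1, (m0 <= m)%N &
    exists2 w : config K L m, admissible w & aligned th w.

Lemma measure_fin_bigcup_le (d : measure_display) (T : measurableType d)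
    (R : realType) (mu : {measure set T -> \bar R}) (I : finType)
    (Q : {pred I}) (F : I -> set T) (c : R) :
  (forall i, i \in Q -> measurable (F i)) ->
  (forall i, i \in Q -> mu (F i) <= c%:E)%E -> 0 <= c ->
  (mu (\bigcup_(i in [set` Q]) F i) <= (#|I|%:R * c)%:E)%E.
Proof.
move=> mF Fc c0; rewrite bigcup_pred.
apply: le_trans (measure_bigsetU_le _ _ _) _ => //.
apply: (@le_trans _ _ (\sum_(i in Q) c%:E)%E); first exact: lee_sum.
rewrite sumEFin lee_fin sumr_const -[c *+ _]mulr_natl.
by rewrite ler_wpM2r// ler_nat max_card.
Qed.

Lemma measurable_some_aligned (R : realType) (K L m0 : nat) (d : measure_display)
    (T : measurableType d) (Theta : 'I_K -> 'I_K -> T -> R) :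
  (forall k j, measurable_fun setT (Theta k j)) ->
  measurable [set t | some_aligned L m0 (fun k j => Theta k j t)].
Proof.
move=> mTh.
rewrite (_ : [set t | _] =
  \bigcup_(m in [set m : 'I_K.+1 | (m0 <= m)%N])
    \bigcup_(w in [set w : config K L m | admissible w])
      [set t | aligned (fun k j => Theta k j t) w]) //.
apply: fin_bigcup_measurable => [|m _]; first exact: finite_finset.
apply: fin_bigcup_measurable => [|w _]; first exact: finite_finset.
exact: measurable_aligned.
Qed.

(** For given m there are (K L)^(2m) 2^(m^2) configurations. Since K L K <= 2^m, this is at most
    2^(3 m^2) / K^(2m), so the block size m contributes at most K^-2. Summing over the K + 1 values
    of m gives (K + 1) / K^2 <= 2 / K. *)
Lemma prob_some_aligned (R : realType) (K L m0 : nat) (d : measure_display)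
    (T : measurableType d) (P : probability T R) (Theta : 'I_K -> 'I_K -> T -> R) :
  iid_uniform_phases P Theta -> (768 <= L)%N -> (0 < K)%N -> (0 < m0)%N ->
  (K * L * K <= 2 ^ m0)%N ->
  (P [set t | some_aligned L m0 (fun k j => Theta k j t)] <= (2 / K%:R)%:E)%E.
Proof.
move=> iid L768 K0 m00 KL; have [mTh _ _] := iid.
have K1 : (1 : R) <= K%:R by rewrite (ler_nat R 1).
rewrite (_ : [set t | _] =
  \bigcup_(m in [set` [pred m : 'I_K.+1 | (m0 <= m)%N]])
    \bigcup_(w in [set` @admissible K L m])
      [set t | aligned (fun k j => Theta k j t) w]) //.
pose A (m : 'I_K.+1) (w : config K L m) :=
  [set t | aligned (fun k j => Theta k j t) w].
pose AA (m : 'I_K.+1) := \bigcup_(w in [set` @admissible K L m]) @A m w.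
apply: le_trans (@measure_fin_bigcup_le _ _ _ P _ _ AA (K%:R ^+ 2)^-1 _ _ _) _.
- move=> m _; apply: fin_bigcup_measurable => [|w _]; first exact: finite_finset.
  exact: measurable_aligned.
- move=> m; rewrite inE => m0m.
  apply: le_trans (@measure_fin_bigcup_le _ _ _ P _ _ (@A m)
    (2 ^- (3 * (m * m))) _ _ _) _.
  + by move=> w _; exact: measurable_aligned.
  + by move=> w adm; exact: prob_aligned.
  + by rewrite invr_ge0 exprn_ge0.
  rewrite lee_fin ler_pdivrMr ?exprn_gt0// mulrC ler_pdivlMr ?exprn_gt0 ?(lt_le_trans _ K1)//.
  rewrite -!natrX -natrM ler_nat card_config.
  have m1 : (1 <= m)%N by apply: leq_trans m0m.
  have KLm : (K * L * K <= 2 ^ m)%N by apply: leq_trans KL _; rewrite leq_exp2l.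
  apply: (@leq_trans ((K * L * K) ^ (2 * m) * 2 ^ (m * m))).
    rewrite mulnAC [in leqRHS]expnMn leq_mul2r leq_mul2l leq_pexp2l ?orbT//.
    by rewrite leq_pmulr.
  have -> : (3 * (m * m) = m * (2 * m) + m * m)%N by lia.
  rewrite expnD leq_mul2r (expnM 2 m (2 * m)); apply/orP; right.
  by rewrite leq_exp2r// muln_gt0.
- by rewrite invr_ge0 exprn_ge0.
rewrite lee_fin card_ord ler_pdivlMr; last lra.
rewrite expr2 invfM !mulrA divfK; last by rewrite gt_eqF//; lra.
by rewrite ler_pdivrMr -?natr1; lra.
Qed.

(** * A receiver with many strong interferers *)

Lemma sum_enumeration (T : finType) (A : {set T}) (m : nat) : #|A| = m ->
  exists f : 'I_m -> T, [/\ injective f, forall u, f u \in A &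
    forall F : T -> nat, (\sum_(j in A) F j = \sum_(u < m) F (f u))%N].
Proof.
move=> <-; exists enum_val; split=> [|u|F].
- exact: enum_val_inj.
- exact: enum_valP.
- exact: big_enum_val.
Qed.

(** Otherwise every receiver in [Lo] has more than half of its links from [Hi] weak. Adding up over
    the receivers, the set [D] of weak links has at least m^2 / 2 elements, and rounding the angles
    gives an aligned admissible configuration. *)
Lemma exists_receiver (R : realType) (K L m0 m : nat) (th : 'I_K -> 'I_K -> R)
    (al ga : 'I_K -> R) (Lo Hi : {set 'I_K}) :
  (2 <= L)%N -> ~ some_aligned L m0 th -> (m0 <= m)%N ->
  #|Lo| = m -> #|Hi| = m ->
  exists2 k, k \in Lo &
    (m <= 2 * #|[set j in Hi | (sin (pi / L%:R) ^+ 2 <= beta_coef th al ga k j)%R]%SET|)%N.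
Proof.
move=> L2 nalign m0m cLo cHi; set dl := sin _ ^+ 2.
apply: contrapT => noreceiver; apply: nalign.
have [grid gridP] := grid_near_null R L2.
have mK : (m < K.+1)%N by rewrite ltnS -cLo -[leqRHS]card_ord max_card.
have [f [f_inj fLo _]] := sum_enumeration cLo.
have [g [g_inj _ gsum]] := sum_enumeration cHi.
pose D := [set p : 'I_m * 'I_m | beta_coef th al ga (f p.1) (g p.2) < dl]%SET.
exists (Ordinal mK) => //=.
(* The direct phase [th j j] is rounded together with [al j] as a single angle, so the condition on
   a link involves only its own phase [th k j]. *)
exists ([ffun u => (f u, grid (ga (f u)))],
        [ffun v => (g v, grid (al (g v) - th (g v) (g v)))], D); last first.
  move=> p /=; rewrite inE !ffunE /= /beta_coef => lt_dl; apply: gridP.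
  by rewrite [X in cos (X - _)]addrAC.
apply/and3P; split=> /=.
- by apply/injectiveP => u v; rewrite !ffunE => /f_inj.
- by apply/injectiveP => u v; rewrite !ffunE => /g_inj.
rewrite -sum1_card big_mkcond /=.
rewrite (eq_bigr (fun p : 'I_m * 'I_m =>
  ((beta_coef th al ga (f p.1) (g p.2) < dl)%R : nat))); last by move=> p _; rewrite inE; case: ifP.
rewrite -(pair_bigA _ (fun u v => ((beta_coef th al ga (f u) (g v) < dl)%R : nat))) /=.
rewrite big_distrr /= -{1}[m]card_ord -sum_nat_const.
apply: leq_sum => u _.
rewrite -(gsum (fun j => ((beta_coef th al ga (f u) j < dl)%R : nat))).
have : ~ (m <= 2 * #|[set j in Hi | (dl <= beta_coef th al ga (f u) j)%R]%SET|)%N.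
  by move=> h; apply: noreceiver; exists (f u).
have -> : #|[set j in Hi | (dl <= beta_coef th al ga (f u) j)%R]%SET| =
    (\sum_(j in Hi) ((dl <= beta_coef th al ga (f u) j)%R : nat))%N.
  by rewrite -sum1_card big_mkcond [RHS]big_mkcond; apply: eq_bigr => j _;
     rewrite inE; case: (j \in Hi) => //=; case: ifP.
have : (\sum_(j in Hi) ((dl <= beta_coef th al ga (f u) j)%R : nat) +
        \sum_(j in Hi) ((beta_coef th al ga (f u) j < dl)%R : nat) = m)%N.
  rewrite -big_split -cHi -sum1_card; apply: eq_bigr => j _ /=.
  by case: (leP dl).
by lia.
Qed.

(** * Removing low-rate users one by one *)

Lemma sum_le_peel (R : realType) (T : finType) (r : T -> R) (b : nat -> R) :
  (forall A : {set T}, A != finset.set0 -> exists2 k, k \in A & r k <= b #|A|) ->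
  \sum_k r k <= \sum_(n < #|T|) b n.+1.
Proof.
move=> peel; suff H n (A : {set T}) : #|A| = n ->
    \sum_(k in A) r k <= \sum_(i < n) b i.+1.
  have := H #|T| [set: T]%SET (cardsT T).
  by under eq_bigl do rewrite inE.
elim: n A => [|n IH] A cA.
  by move/eqP: cA; rewrite cards_eq0 => /eqP ->; rewrite big_set0 big_ord0.
have [|k kA rk] := peel A; first by rewrite -card_gt0 cA.
rewrite (big_setD1 k)//= big_ord_recr /= addrC lerD//; last by rewrite -cA.
by apply: IH; have := cardsD1 k A; rewrite kA cA => -[].
Qed.

(** Greedy choice: keep adding a minimiser of [p] among the remaining elements. *)
Lemma lowest_subset (R : realType) (T : finType) (p : T -> R) (A : {set T})
    (m : nat) : (m <= #|A|)%N ->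
  exists B : {set T}, [/\ B \subset A, #|B| = m &
    forall k j, k \in B -> j \in A :\: B -> p k <= p j].
Proof.
elim: m => [_|m IH mA].
  by exists finset.set0; split; rewrite ?finset.sub0set ?cards0// => k j; rewrite inE.
have [B [BA cB Bmin]] := IH (ltnW mA).
have /card_gt0P[i0 i0D] : (0 < #|A :\: B|)%N.
  by rewrite cardsD (finset.setIidPr BA) cB subn_gt0.
case: (Order.TotalTheory.arg_minP p i0D) => i iD imin.
move: (iD) => /finset.setDP[iA iB].
exists (i |: B)%SET; split.
- by rewrite finset.subUset finset.sub1set iA.
- by rewrite cardsU1 iB cB.
move=> k j; rewrite !inE negb_or => /orP[/eqP ->|kB] /andP[/andP[ji jB] jA].
  by apply: imin; apply/finset.setDP.
by apply: Bmin => //; rewrite inE jB.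
Qed.

(** This is ln (1 - 1/n) <= - 1/n; it lets the harmonic sum telescope to a logarithm. *)
Lemma inv_le_ln_diff (R : realType) (n : nat) : (1 < n)%N ->
  n%:R^-1 <= ln n%:R - ln n.-1%:R :> R.
Proof.
case: n => [//|n]; rewrite ltnS => n0 /=.
have n0R : (0 : R) < n%:R by rewrite ltr0n.
have n1R : (0 : R) < n.+1%:R by rewrite ltr0n.
have := @le_ln1Dx R (- n.+1%:R^-1).
have -> : 1 + - n.+1%:R^-1 = n%:R / n.+1%:R :> R.
  by rewrite -[n%:R](addrK 1) natr1 mulrBl mul1r divff ?lt0r_neq0.
rewrite ln_div ?posrE// => H; have : -1 < - n.+1%:R^-1 :> R.
  by rewrite ltrN2 invf_lt1// ltr1n.
by rewrite -lerN2 opprB => /H.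
Qed.

Lemma user_rate_le (R : realType) (p b s : R) :
  0 <= p -> 0 <= b <= 1 -> 0 <= s -> ln (1 + p * b / (s + 2^-1)) <= p / (s + 2^-1).
Proof.
move=> p0 /andP[b0 b1] s0.
have s1 : 0 < s + 2^-1 by lra.
have x0 : 0 <= p * b / (s + 2^-1) by rewrite !mulr_ge0// invr_ge0 ltW.
apply: le_trans (le_ln1Dx _) _; first lra.
by rewrite ler_pM2r ?invr_gt0//; rewrite -[leRHS]mulr1 ler_wpM2l.
Qed.

Lemma beta_coef_itv (R : realType) (K : nat) (th : 'I_K -> 'I_K -> R)
    (al ga : 'I_K -> R) (k j : 'I_K) : 0 <= beta_coef th al ga k j <= 1.
Proof.
by rewrite /beta_coef sqr_ge0 /= -(cos2Dsin2 (al j + th k j - th j j - ga k)) lerDl sqr_ge0.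
Qed.

(** Take [Lo] as the less powerful half of [A] and [Hi] among the others. The receiver k from
    [exists_receiver] has a set [G] of strong interferers with power at least [Pw k], so its
    interference is at least #|G| * Pw k * dl. The power of k then cancels from the bound on its
    rate. *)
Lemma exists_low_rate (R : realType) (K L m0 : nat) (th : 'I_K -> 'I_K -> R)
    (Pw al ga : 'I_K -> R) (A : {set 'I_K}) :
  (2 <= L)%N -> (0 < m0)%N -> ~ some_aligned L m0 th ->
  (forall k, 0 <= Pw k <= 1) -> (2 * m0 <= #|A|)%N ->
  exists2 k, k \in A &
    ln (1 + Pw k * beta_coef th al ga k k /
            (\sum_(j < K | j != k) Pw j * beta_coef th al ga k j + 2^-1))
      <= 6 / sin (pi / L%:R) ^+ 2 / #|A|%:R.
Proof.
move=> L2 m00 nalign Pw01 m0A; set dl := sin _ ^+ 2; set n := #|A|.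
have p0 := pi_gt0 R.
have L2R : (2 : R) <= L%:R by rewrite (ler_nat R 2).
have dl0 : 0 < dl.
  apply: exprn_gt0; apply: sin_gt0_pi; rewrite divr_gt0 //=; last lra.
  by rewrite ltr_pdivrMr; nra.
have nh : (n./2 <= n)%N by lia.
have [Lo [LoA cLo Lomin]] := lowest_subset Pw nh.
have [|Hi [HiA cHi _]] := @lowest_subset R _ Pw (A :\: Lo) n./2.
  by rewrite cardsD (finset.setIidPr LoA) cLo -/n; lia.
have m0n : (m0 <= n./2)%N by move: m0A; rewrite -/n; lia.
have [k kLo kHi] := exists_receiver al ga L2 nalign m0n cLo cHi.
exists k; first exact: (fintype.subsetP LoA).
move: kHi; set G := [set j in Hi | _]%SET => kHi.
have Pk := Pw01 k.
have bk (j : 'I_K) := beta_coef_itv th al ga k j.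
have term0 (j : 'I_K) : 0 <= Pw j * beta_coef th al ga k j.
  by have /andP[? _] := Pw01 j; have /andP[? _] := bk j; exact: mulr_ge0.
set S := \sum_(j < K | _) _.
have S0 : 0 <= S by apply: sumr_ge0.
have SG : #|G|%:R * (Pw k * dl) <= S.
  rewrite mulr_natl -sumr_const /S big_mkcond [leRHS]big_mkcond /=.
  apply: ler_sum => j _; case: ifPn => [|_]; last by case: ifP.
  rewrite inE => /andP[jHi dlj].
  have /andP[jLo jA] : (j \notin Lo) && (j \in A).
    by have := fintype.subsetP HiA _ jHi; rewrite inE.
  have -> : j != k by apply: contraNneq jLo => ->.
  apply: ler_pM => //; [by case/andP: Pk|exact: ltW|].
  by apply: Lomin => //; rewrite inE jLo.
apply: le_trans (user_rate_le _ (bk k) S0) _; first by case/andP: Pk.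
(* Rounding in [n./2] only gives n <= 4 #|G| + 1; as n >= 2 forces #|G| >= 1, the factor 6 is
   enough. *)
have nG : n%:R <= 6 * #|G|%:R :> R.
  have h (a b : nat) : (b./2 <= 2 * a -> 2 * m0 <= b -> b <= 6 * a)%N by lia.
  by rewrite -(natrM R 6) ler_nat; apply: h.
have n0 : 0 < n%:R :> R by rewrite ltr0n; move: m0A; rewrite -/n; lia.
rewrite ler_pdivrMr; last lra.
rewrite mulrAC ler_pdivlMr// mulrAC ler_pdivlMr//.
have : n%:R * (Pw k * dl) <= 6 * #|G|%:R * (Pw k * dl).
  by apply: ler_wpM2r nG; rewrite mulr_ge0 ?(ltW dl0)//; case/andP: Pk.
by nra.
Qed.

Lemma Rsum_le (R : realType) (K L m0 : nat) (th : 'I_K -> 'I_K -> R)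
    (Pw al ga : 'I_K -> R) :
  (2 <= L)%N -> (0 < m0)%N -> ~ some_aligned L m0 th ->
  (forall k, 0 <= Pw k <= 1) ->
  Rsum th Pw al ga <= 6 / sin (pi / L%:R) ^+ 2 * ln K%:R + 4 * m0%:R.
Proof.
move=> L2 m00 nalign Pw01; set c := 6 / _ ^+ 2.
have c0 : 0 <= c by rewrite divr_ge0 ?sqr_ge0.
(* The first term dominates c / n for n > 1 and telescopes. Below 2 m0 users no low rate is
   guaranteed, but noise 1/2 and power at most 1 cap any rate at 2; this costs at most 2 * (2 m0) in
   all. *)
pose b n : R := c * (ln n%:R - ln n.-1%:R) + (if (n < 2 * m0)%N then 2 else 0).
have ln_mono n : (0 < n)%N -> 0 <= ln n%:R - ln n.-1%:R :> R.
  (* At n = 1 the convention ln 0 = 0 makes the difference vanish; it also makes the telescoped sum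
     equal to ln K. *)
  case: n => [//|[|n]] _; first by rewrite ln1 ln0// subr0.
  by apply: le_trans (inv_le_ln_diff _ _) => //; rewrite invr_ge0.
rewrite /Rsum; apply: (@le_trans _ _ (\sum_(n < #|'I_K|) b n.+1)).
  apply: sum_le_peel => A A0.
  have A1 : (0 < #|A|)%N by rewrite card_gt0.
  rewrite /b; case: ifPn => [_|]; last first.
    rewrite -leqNgt => m0A.
    have [k kA rk] := exists_low_rate al ga L2 m00 nalign Pw01 m0A.
    exists k => //; apply: le_trans rk _; rewrite addr0.
    apply: ler_wpM2l => //; apply: inv_le_ln_diff.
    by apply: leq_trans m0A; rewrite leq_pmulr.
  have /card_gt0P[k kA] := A1; exists k => //.
  have /andP[Pk0 Pk1] := Pw01 k.
  have S0 : 0 <= \sum_(j < K | j != k) Pw j * beta_coef th al ga k j.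
    apply: sumr_ge0 => j _; have /andP[? _] := Pw01 j.
    by have /andP[? _] := beta_coef_itv th al ga k j; exact: mulr_ge0.
  apply: le_trans (user_rate_le Pk0 (beta_coef_itv _ _ _ _ _) S0) _.
  apply: (@le_trans _ _ 2); last by rewrite lerDr mulr_ge0// ln_mono.
  by rewrite ler_pdivrMr; lra.
rewrite card_ord {}/b big_split /=; apply: lerD.
  rewrite -mulr_sumr ler_wpM2l//.
  rewrite -(big_mkord xpredT (fun n => ln n.+1%:R - ln n%:R)) telescope_sumr//.
  by rewrite [ln 0]ln0// subr0.
have H n : \sum_(i < n) (if (i.+1 < 2 * m0)%N then 2 else 0 : R) <= 2 * (minn n (2 * m0))%:R.
  elim: n => [|n IH]; first by rewrite big_ord0 mulr_ge0.
  rewrite big_ord_recr /=; case: ifPn => nm.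
    have -> : minn n.+1 (2 * m0) = (minn n (2 * m0)).+1 by lia.
    by rewrite -natr1; lra.
  rewrite addr0; apply: le_trans IH _; rewrite ler_wpM2l// ler_nat; lia.
apply: le_trans (H K) _.
have : (minn K (2 * m0))%:R <= (2 * m0)%:R :> R by rewrite ler_nat geq_minr.
by rewrite natrM; lra.
Qed.

(** * Measurability of the sum-rate event *)

(* Division-free form, making measurability and continuity immediate. *)
Lemma Rsum_lnB (R : realType) (K : nat) (th : 'I_K -> 'I_K -> R)
    (Pw al ga : 'I_K -> R) : (forall k, 0 <= Pw k) ->
  let S k := \sum_(j < K | j != k) Pw j * beta_coef th al ga k j + 2^-1 in
  (forall k, 0 < S k /\ 0 < S k + Pw k * beta_coef th al ga k k) /\
  Rsum th Pw al ga =
  \sum_(k < K) (ln (S k + Pw k * beta_coef th al ga k k) - ln (S k)).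
Proof.
move=> Pw0 S.
have t0 k j : 0 <= Pw j * beta_coef th al ga k j.
  by rewrite mulr_ge0//; case/andP: (beta_coef_itv th al ga k j).
have S0 k : 0 < S k by apply: ltr_wpDl; [exact: sumr_ge0|rewrite invr_gt0].
have SP k : 0 < S k + Pw k * beta_coef th al ga k k by rewrite ltr_wpDr.
split=> //; apply: eq_bigr => k _; rewrite -/(S k) -ln_div ?posrE//.
by congr ln; rewrite mulrDl divff ?lt0r_neq0.
Qed.

Lemma measurable_Rsum (R : realType) (K : nat) (d : measure_display)
    (T : measurableType d) (Theta : 'I_K -> 'I_K -> T -> R)
    (Pw al ga : 'I_K -> R) :
  (forall k j, measurable_fun setT (Theta k j)) -> (forall k, 0 <= Pw k) ->
  measurable_fun setT (fun t => Rsum (fun k j => Theta k j t) Pw al ga).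
Proof.
move=> mTh Pw0.
have mb k j : measurable_fun setT
    (fun t => beta_coef (fun k j => Theta k j t) al ga k j).
  apply: measurable_funX; apply: measurableT_comp.
    by apply: continuous_measurable_fun; exact: continuous_cos.
  by apply: measurable_funB => //; apply: measurable_funB => //;
     apply: measurable_funD.
have mS k : measurable_fun setT (fun t =>
    \sum_(j < K | j != k) Pw j * beta_coef (fun k j => Theta k j t) al ga k j + 2^-1).
  apply: measurable_funD => //.
  under eq_fun do rewrite big_mkcond.
  apply: measurable_sum => j; case: (j != k) => //.
  exact: measurable_funM.
under eq_fun => t do
  rewrite (Rsum_lnB (fun k j => Theta k j t) al ga Pw0).2.
apply: measurable_sum => k; apply: measurable_funB.
  apply: measurableT_comp; first exact: measurable_ln.
  by apply: measurable_funD => //; apply: measurable_funM.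
by apply: measurableT_comp; first exact: measurable_ln.
Qed.

Lemma cvg_sum_seq (R : realType) (I : Type) (s : seq I) (Q : pred I)
    (u : I -> nat -> R) (l : I -> R) :
  (forall i, Q i -> u i n @[n --> \oo] --> l i) ->
  \sum_(i <- s | Q i) u i n @[n --> \oo] --> \sum_(i <- s | Q i) l i.
Proof.
move=> ul; elim: s => [|i s IH].
  by rewrite big_nil; under eq_fun do rewrite big_nil; exact: cvg_cst.
rewrite big_cons; under eq_fun do rewrite big_cons.
by case: ifPn => // Qi; apply: cvgD => //; exact: ul.
Qed.

(** Sequential continuity in powers and angles for fixed phases. Nonnegative powers and the noise
    1/2 keep the arguments of [ln] positive, where it is continuous. *)
Lemma cvg_Rsum (R : realType) (K : nat) (th : 'I_K -> 'I_K -> R)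
    (Pw al ga : 'I_K -> R) (pn an gn : nat -> 'I_K -> R) :
  (forall k, 0 <= Pw k) -> (forall n k, 0 <= pn n k) ->
  (forall k, pn n k @[n --> \oo] --> Pw k) ->
  (forall k, an n k @[n --> \oo] --> al k) ->
  (forall k, gn n k @[n --> \oo] --> ga k) ->
  Rsum th (pn n) (an n) (gn n) @[n --> \oo] --> Rsum th Pw al ga.
Proof.
move=> Pw0 pn0 pP aA gG.
have [S0 ->] := Rsum_lnB th al ga Pw0.
under eq_fun => n do rewrite (Rsum_lnB th (an n) (gn n) (pn0 n)).2.
have cb k j : beta_coef th (an n) (gn n) k j @[n --> \oo] --> beta_coef th al ga k j.
  rewrite /beta_coef.
  have cc : cos (an n j + th k j - th j j - gn n k) @[n --> \oo] -->
            cos (al j + th k j - th j j - ga k).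
    apply: (cvg_comp _ cos); last exact: continuous_cos.
    apply: cvgB => //; apply: cvgB; last exact: cvg_cst.
    by apply: cvgD => //; exact: cvg_cst.
  exact: (cvgM cc cc).
have ct k j : pn n j * beta_coef th (an n) (gn n) k j @[n --> \oo] -->
    Pw j * beta_coef th al ga k j by apply: cvgM.
have cS k : \sum_(j < K | j != k) pn n j * beta_coef th (an n) (gn n) k j + 2^-1
    @[n --> \oo] --> \sum_(j < K | j != k) Pw j * beta_coef th al ga k j + 2^-1.
  by apply: cvgD; [apply: cvg_sum_seq => j _; exact: ct|exact: cvg_cst].
apply: cvg_sum_seq => k _; have [Sk SPk] := S0 k; apply: cvgB.
  apply: (cvg_comp _ (@ln R)); last exact: continuous_ln.
  by apply: cvgD; [exact: cS|exact: ct].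
by apply: (cvg_comp _ (@ln R)); [exact: cS|exact: continuous_ln].
Qed.

(** The approximants stay strictly inside the interval even when x is an endpoint, so they remain
    legitimate powers or angles. *)
Lemma rat_approx (R : realType) (a b x : R) : a < b -> a <= x <= b ->
  exists q : nat -> rat,
    (forall n, a < ratr (q n) < b) /\ (ratr (q n) : R) @[n --> \oo] --> x.
Proof.
move=> ab /andP[ax xb].
have /choice[q qP] : forall n : nat, exists q : rat,
    (a < ratr q < b) /\ `|x - ratr q| < n.+1%:R^-1.
  move=> n; have : (0 : R) < n.+1%:R^-1 by rewrite invr_gt0.
  move: n.+1%:R^-1 => e e0.
  have [|q] := @rat_in_itvoo R (Num.max a (x - e)) (Num.min b (x + e)).
    by rewrite gt_max !lt_min ab /=; apply/and3P; split; lra.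
  rewrite in_itv /= gt_max lt_min => /andP[/andP[q1 q2] /andP[q3 q4]].
  by exists q; rewrite q1 q3 ltr_norml; split=> //; lra.
exists q; split=> [n|]; first by case: (qP n).
apply/cvgrPdist_lt => e e0.
have [N _ NP] := near_infty_natSinv_lt (PosNum e0).
by exists N => // n /= Nn; apply: lt_trans (qP n).2 _; exact: NP.
Qed.

(* By continuity the parameters can be restricted to a countable dense set. *)
Lemma measurable_max_sumrate_le (R : realType) (K : nat) (d : measure_display)
    (T : measurableType d) (Theta : 'I_K -> 'I_K -> T -> R) (c : R) :
  (forall k j, measurable_fun setT (Theta k j)) ->
  measurable [set t | max_sumrate_le (fun k j => Theta k j t) c].
Proof.
move=> mTh; have p0 := pi_gt0 R.
pose J : Type := ({ffun 'I_K -> rat} * {ffun 'I_K -> rat} * {ffun 'I_K -> rat})%type.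
pose v (f : {ffun 'I_K -> rat}) k : R := ratr (f k).
pose valid (w : J) := (forall k, 0 < v w.1.1 k < 1) /\
  (forall k, - pi < v w.1.2 k < pi) /\ (forall k, - pi < v w.2 k < pi).
pose E (w : J) : set T := [set t | valid w ->
  Rsum (fun k j => Theta k j t) (v w.1.1) (v w.1.2) (v w.2) <= c].
have -> : [set t | max_sumrate_le (fun k j => Theta k j t) c] =
    ~` \bigcup_w ~` E w.
  rewrite setC_bigcup; under eq_bigcapr do rewrite setCK.
  apply/seteqP; split => t /= tmax.
    move=> w _ [Pv [av gv]].
    apply: tmax => k; first by case/andP: (Pv k) => *; rewrite !ltW.
      by case/andP: (av k) => *; rewrite ltW.
    by case/andP: (gv k) => *; rewrite ltW.
  move=> Pw al ga Pw01 alpi gapi.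
  have pp : - pi < pi :> R by lra.
  have /choice[pq /all_and2[pq1 pq2]] k := rat_approx ltr01 (Pw01 k).
  have apprpi (x : R) : - pi <= x < pi -> - pi <= x <= pi.
    by case/andP => -> /ltW.
  have /choice[aq /all_and2[aq1 aq2]] k := rat_approx pp (apprpi _ (alpi k)).
  have /choice[gq /all_and2[gq1 gq2]] k := rat_approx pp (apprpi _ (gapi k)).
  pose w n : J := ([ffun k => pq k n], [ffun k => aq k n], [ffun k => gq k n]).
  have := @cvg_Rsum R K (fun k j => Theta k j t) Pw al ga
    (fun n k => ratr (pq k n)) (fun n k => ratr (aq k n)) (fun n k => ratr (gq k n)).
  move=> /(_ _ _ pq2 aq2 gq2) H.
  (* The bound [c] holds along the rational approximants and passes to their limit. *)
  apply: (cvgr_to_le (H _ _)) => [k|n k|]; first by case/andP: (Pw01 k).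
    by case/andP: (pq1 k n) => /ltW.
  apply: nearW => n; have := tmax (w n) I; rewrite /E /= /valid /v /=.
  have e1 (f : 'I_K -> nat -> rat) :
      (fun k => ratr ([ffun k => f k n] k) : R) = (fun k => ratr (f k n)).
    by apply/funext => k; rewrite ffunE.
  by rewrite !e1; apply; split=> [k|]; [|split=> k]; rewrite ffunE.
apply: measurableC; apply: countable_bigcupT_measurable; first exact: countableP.
move=> w; apply: measurableC; have [vw|nvw] := pselect (valid w); last first.
  rewrite (_ : E w = setT)//; apply/seteqP; split=> // t _ vw.
  by case: (nvw vw).
rewrite (_ : E w = (fun t => Rsum (fun k j => Theta k j t) (v w.1.1) (v w.1.2) (v w.2))
    @^-1` `]-oo, c]%classic).
  rewrite -[X in measurable X]setTI; apply: measurable_Rsum => //.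
  by move=> k; case/andP: (vw.1 k) => /ltW.
apply/seteqP; split => t; rewrite /E /= in_itv /=; first by apply.
by [].
Qed.

(** * Choice of the constants and conclusion *)

Theorem theorem2 (R : realType) :
  exists C : R, 0 < C /\
    forall eps : R, 0 < eps ->
      exists K0 : nat, forall K : nat, (K0 <= K)%N ->
        forall (d : measure_display) (T : measurableType d)
               (P : probability T R) (Theta : 'I_K -> 'I_K -> T -> R),
          iid_uniform_phases P Theta ->
          ((1 - eps)%:E <=
             P [set t | max_sumrate_le (fun k j => Theta k j t) (C * ln K%:R)])%E.
Proof.
have [L L768] : exists L : nat, (768 <= L)%N by exists 768%N.
have L2 : (2 <= L)%N by apply: leq_trans L768.
set c : R := 6 / sin (pi / L%:R) ^+ 2.
have c0 : 0 <= c by rewrite divr_ge0 ?sqr_ge0.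
have ln2 : 0 < ln 2 :> R by rewrite ln_gt0// ltr1n.
(* The term 4 m0 of [Rsum_le] will be 12 (l + 1) <= 24 l, with l <= ln K / ln 2. *)
exists (c + 24 / ln 2); split; first by rewrite ltr_wpDl ?divr_gt0.
(* [L <= K] is for the choice of [m0]; K > 2 / eps makes the failure probability 2 / K at most
   eps. *)
move=> eps eps0; exists (maxn L (Num.truncn (2 / eps)).+1) => K.
rewrite geq_max => /andP[LK epsK] d T P Theta iid.
have K2 : (2 <= K)%N by apply: leq_trans LK.
have K0 : 0 < K%:R :> R by rewrite ltr0n ltnW.
pose l := trunc_log 2 K.
have /andP[lK Kl] := @trunc_log_bounds 2 K isT (ltnW K2).
have l1 : (1 <= l)%N by rewrite trunc_log_gt0// K2.
(* From L <= K < 2^(l+1) follows K L K <= K^3 <= 2^(3 (l+1)), as the union bound requires. *)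
pose m0 := (3 * l.+1)%N.
have KLK : (K * L * K <= 2 ^ m0)%N.
  apply: (@leq_trans (K * K * K)); first by rewrite leq_mul2r leq_mul2l LK !orbT.
  rewrite /m0 (mulnC 3%N) expnM; have -> : (K * K * K = K ^ 3)%N by rewrite !expnS expn0; lia.
  by rewrite leq_exp2r// ltnW.
have [mTh _ _] := iid.
pose A := [set t | some_aligned L m0 (fun k j => Theta k j t)].
have mA : measurable A by exact: measurable_some_aligned.
apply: (@le_trans _ _ (P (~` A))).
  rewrite probability_setC// EFinB; apply: leeB => //.
  apply: le_trans (prob_some_aligned iid L768 (ltnW K2) _ KLK) _ => //.
  rewrite lee_fin ler_pdivrMr// -ler_pdivrMl//.
  apply: ltW; rewrite mulrC; apply: lt_le_trans (truncnS_gt _) _.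
  by rewrite ler_nat.
(* Monotonicity of [P] is applied to measurable sets, so the sum-rate event, a condition on a
   continuum of parameters, has to be shown measurable. *)
apply: le_measure; rewrite ?inE; first exact: measurableC.
  exact: measurable_max_sumrate_le.
move=> t /= nA Pw al ga Pw01 _ _.
apply: le_trans (Rsum_le al ga L2 _ nA Pw01) _ => //.
rewrite -/c (mulrDl c) lerD2l mulrAC ler_pdivlMr//.
have lnK : l%:R * ln 2 <= ln K%:R :> R.
  by rewrite mulr_natl -lnXn// ler_ln ?posrE ?exprn_gt0// -natrX ler_nat.
have l1R : (1 : R) <= l%:R by rewrite (ler_nat R 1).
have -> : m0%:R = 3 * (l%:R + 1) :> R by rewrite natrM natr1.
by nra.
Qed.
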